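(* Let $K_{m_1,\ldots,m_k}$ be a complete multipartite graph with $k\ge 2$, $1\le m_1\le m_2\le\cdots\le m_k$ and $m_k\ge 2$, and let $V$ be its vertex set. Let $\lambda:=|\{i\mid m_i\ge 2\}|$ and suppose $\lambda\ge 2$. Let $d:=m_k-\sum_{i=1}^{k-1}(m_i-1)$. Then \[ \operatorname{nim}(\mathrm{TER}(K_{m_1,\ldots,m_k}))=\begin{cases} 0, & |V| \text{ even and } d \leq 1 \\ 1, & |V| \text{ even and } 2 \leq d \\ 1, & |V| \text{ odd and } d \leq 0 \\ 2, & |V| \text{ odd and } d \in \{1, 2\} \\ 0, & |V| \text{ odd and } 3 \leq d. \end{cases} \]
   Context: For a graph $G$ with vertex set $V$, a set $K\subseteq V$ is convex if it contains every vertex lying on any shortest path between two elements of $K$. The convex hull $[P]$ of $P\subseteq V$ is the smallest convex set containing $P$. The game $\mathrm{TER}(G)$: positions are the sets $P\subseteq V$ reachable from the starting position $\emptyset$ by the following moves. If $[V\setminus P]=V$, then the options of $P$ are all sets $P\cup\{v\}$ with $v\in V\setminus P$; if $[V\setminus P]\neq V$, then $P$ is terminal (has no options). The nim-value of a position is defined recursively by $\operatorname{nim}(p)=\operatorname{mex}\{\operatorname{nim}(q): q\text{ an option of }p\}$, where $\operatorname{mex}(A)$ is the smallest nonnegative integer not in $A$; the nim-value of a game is that of its starting position. *)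

(* Defs.v *)
From HB Require Import structures.
From mathcomp Require Import all_boot.
From mathcomp Require Import boolp.

Set Implicit Arguments.
Unset Strict Implicit.
Unset Printing Implicit Defensive.

Record sgraph := SGraph {
  vertex :> finType;
  adj : rel vertex;
  adj_sym : symmetric adj;
  adj_irr : irreflexive adj }.

Section Convexity.
Variable G : sgraph.
Implicit Types (x y : G) (p q : seq G) (K P : {set G}).

(* As in path.v, the walk x :: p has size p edges. *)
Definition walk x y p : Prop := path (@adj G) x p /\ last x p = y.

Definition shortest_path x y p : Prop :=
  walk x y p /\ forall q, walk x y q -> size p <= size q.

Definition convex K : Prop :=
  forall x y p, x \in K -> y \in K -> shortest_path x y p ->
  forall v, v \in x :: p -> v \in K.

Definition hull P : {set G} :=
  \bigcap_(K : {set G} | `[< convex K >] && (P \subset K)) K.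

Lemma sub_hull P : P \subset hull P.
Proof. by apply/bigcapsP => K /andP[]. Qed.

Lemma convex_hull P : convex (hull P).
Proof.
move=> x y p xH yH sp v vp; apply/bigcapP => K KP.
have [/asboolP cK _] := andP KP.
by apply: (cK x y p) => //; [move/bigcapP: xH | move/bigcapP: yH]; apply.
Qed.

Lemma hull_min P K : convex K -> P \subset K -> hull P \subset K.
Proof. by move=> /asboolP cK PK; apply: bigcap_inf; rewrite cK. Qed.

End Convexity.

Lemma mex_exists (s : seq nat) : exists n, n \notin s.
Proof.
exists (\max_(i <- s) i).+1; apply/negP => /(@leq_bigmax_seq _ _ predT id).
by move/(_ isT); rewrite ltnn.
Qed.

Definition mex (s : seq nat) : nat := ex_minn (mex_exists s).

Section TerminateGame.
Variable G : sgraph.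
Implicit Types P Q : {set G}.

Definition ter_options P : {set {set G}} :=
  if hull (~: P) == [set: G] then [set v |: P | v in ~: P] else set0.

(* A move adds a vertex, so #|~: P|.+1 levels of recursion suffice; ter_nimE is
   the resulting mex recursion. It is stated for every subset P, reachable from
   set0 or not; options of reachable sets are reachable. *)
Fixpoint ter_nim_rec (n : nat) P : nat :=
  if n is n'.+1 then mex [seq ter_nim_rec n' Q | Q in ter_options P] else 0.

Definition ter_nim P : nat := ter_nim_rec #|~: P|.+1 P.

Lemma ter_options_card P Q : Q \in ter_options P -> #|~: P| = #|~: Q|.+1.
Proof.
rewrite /ter_options; case: ifP => _; last by rewrite inE.
case/imsetP => v vP ->; rewrite (cardsD1 v (~: P)) vP add1n.
by congr (#|pred_of_set _|.+1); apply/setP => x; rewrite !inE negb_or.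
Qed.

Lemma ter_nimE P : ter_nim P = mex [seq ter_nim Q | Q in ter_options P].
Proof.
rewrite /ter_nim [LHS]/=; congr mex; apply/eq_in_map => Q.
by rewrite mem_enum => /ter_options_card ->.
Qed.

Definition nim_TER : nat := ter_nim set0.

End TerminateGame.

Section CompleteMultipartite.
Variables (k : nat) (m : 'I_k -> nat).

(* The vertex Tagged _ j, with tag i, is the j-th vertex of the i-th part. *)
Definition cmp_vertex : finType := {i : 'I_k & 'I_(m i)}.

Definition cmp_adj : rel cmp_vertex := fun x y => tag x != tag y.

Lemma cmp_adj_sym : symmetric cmp_adj.
Proof. by move=> x y; rewrite /cmp_adj eq_sym. Qed.

Lemma cmp_adj_irr : irreflexive cmp_adj.
Proof. by move=> x; rewrite /cmp_adj eqxx. Qed.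

Definition complete_multipartite : sgraph := SGraph cmp_adj_sym cmp_adj_irr.

End CompleteMultipartite.

(* Main.v *)
Require Import Defs.
From mathcomp Require Import all_boot all_order all_algebra.
From mathcomp Require Import boolp zify.

Set Implicit Arguments.
Unset Strict Implicit.
Unset Printing Implicit Defensive.

Import Order.TTheory GRing.Theory Num.Theory.

(** When two parts have at least two vertices, a set spans the whole graph iff it
    contains two vertices of a common part, so a position is determined by the
    numbers of remaining vertices in the parts and is terminal iff they are all
    at most 1.  The value of any other position is again given by the formula of
    the theorem, provided empty parts contribute 0 (not -1) to the sum in [d].
    To check the mex recursion: taking a vertex of a part of size 1 preserves
    [d], taking one from the largest part lowers [d] by 1 if that part is the
    only largest one, and any other move raises [d] by 1. *)

Lemma mex_eq (s : seq nat) n :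
  n \notin s -> (forall j, j < n -> j \in s) -> mex s = n.
Proof.
move=> ns lts; rewrite /mex; case: ex_minnP => j js minj.
apply/eqP; rewrite eqn_leq minj //= leqNgt.
by apply: contra js; apply: lts.
Qed.

(** * Part sizes and the mex recursion on them *)

Section PartCounts.
Variable I : finType.
Implicit Types (c : I -> nat) (i j : I).

Definition total c := \sum_i c i.
Definition excess c := \sum_i (c i).-1.
Definition largest c := \max_i c i.
Definition decr c i : I -> nat := fun j => c j - (j == i).

(* Here [M] is the largest part and [E] the excess, which counts the largest part
   too, so that [d = 2 * M - 1 - E]. *)
Definition nim_stats (b : bool) (M E : nat) : nat :=
  if M < 2 then 0
  else if ~~ b then (E + 2 < 2 * M : nat)
  else if 2 * M <= E + 1 then 1 else if 2 * M <= E + 3 then 2 else 0.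

Definition nim_counts c := nim_stats (odd (total c)) (largest c) (excess c).

Lemma total_decr c i : 0 < c i -> total c = (total (decr c i)).+1.
Proof.
move=> ci; rewrite /total (bigD1 i) //= [in RHS](bigD1 i) //= {1}/decr eqxx.
rewrite (eq_bigr c (F1 := decr c i)); first by lia.
by move=> j /negPf ji; rewrite /decr ji subn0.
Qed.

Lemma excess_decr c i : 0 < c i -> excess c = excess (decr c i) + (1 < c i).
Proof.
move=> ci; rewrite /excess (bigD1 i) //= [in RHS](bigD1 i) //= {1}/decr eqxx.
rewrite (eq_bigr (fun j => (c j).-1) (F1 := fun j => (decr c i j).-1)).
  by lia.
by move=> j /negPf ji; rewrite /decr ji subn0.
Qed.

Lemma leq_largest c i : c i <= largest c.
Proof. exact: leq_bigmax. Qed.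

(** The part [j] is untouched and still attains the maximum. *)
Lemma largest_decr c i j : j != i -> c j = largest c ->
  largest (decr c i) = largest c.
Proof.
move=> /negPf ji cj; apply/eqP; rewrite eqn_leq; apply/andP; split.
  by apply/bigmax_leqP => l _; apply: leq_trans (leq_largest c l); apply: leq_subr.
by rewrite -{1}cj; apply: leq_trans (leq_largest _ j); rewrite /decr ji subn0.
Qed.

Lemma largest_decr_uniq c i : c i = largest c ->
  (forall j, j != i -> c j < largest c) ->
  largest (decr c i) = (largest c).-1.
Proof.
move=> ci uniqi; apply/eqP; rewrite eqn_leq; apply/andP; split.
  apply/bigmax_leqP => l _; rewrite /decr.
  by case: eqVneq => [->|/uniqi]; lia.
by apply: leq_trans (leq_largest _ i); rewrite /decr eqxx -ci subn1.
Qed.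

Lemma excess_two c i j : i != j -> (c i).-1 + (c j).-1 <= excess c.
Proof.
by move=> ij; rewrite /excess (bigD1 i) //= (bigD1 j) 1?eq_sym //= addnA leq_addr.
Qed.

Lemma exists_excess c i : (c i).-1 < excess c -> exists2 j, j != i & 1 < c j.
Proof.
rewrite /excess (bigD1 i) //= -[X in X < _]addn0 ltn_add2l lt0n.
by rewrite sum_nat_eq0 => /forall_inPn[j ji nz]; exists j => //; lia.
Qed.

Lemma exists_total c i : c i < total c -> exists2 j, j != i & 0 < c j.
Proof.
rewrite /total (bigD1 i) //= -[X in X < _]addn0 ltn_add2l lt0n.
by rewrite sum_nat_eq0 => /forall_inPn[j ji nz]; exists j => //; rewrite lt0n.
Qed.

(** The parts [i] and [j] exhaust the excess, so all others have at most one vertex, and the total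
    forces one of them to be nonempty. Taking its vertex preserves d. *)
Lemma exists_third c i j : i != j -> excess c = (c i).-1 + (c j).-1 ->
  total c != c i + c j -> exists2 l, (l != i) && (l != j) & c l = 1.
Proof.
move=> ij; have D F : \sum_l F l = F i + F j + \sum_(l | (l != i) && (l != j)) F l.
  by rewrite (bigD1 i) //= (bigD1 j) 1?eq_sym //= addnA.
rewrite /excess /total !D -[X in _ = X -> _]addn0 -[X in _ != X -> _]addn0.
move=> /addnI/eqP; rewrite eqn_add2l !sum_nat_eq0 => /forall_inP ex0.
by move=> /forall_inPn[l lij nz]; exists l => //; have := ex0 l lij; lia.
Qed.

Lemma nim_counts_small c : (forall i, c i <= 1) -> nim_counts c = 0.
Proof. by move=> c1; rewrite /nim_counts /nim_stats ltnS ifT //; apply/bigmax_leqP. Qed.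

(** A nonempty part has more vertices than it adds to the excess. Combined with the parity of the
    total, this shows below that a largest part is not alone. *)
Lemma excess_lt_total c i : 0 < c i -> excess c < total c.
Proof.
move=> ci; rewrite /excess /total (bigD1 i) //= [ltnRHS](bigD1 i) //=.
have: \sum_(j | j != i) (c j).-1 <= \sum_(j | j != i) c j.
  by apply: leq_sum => j _; apply: leq_pred.
by lia.
Qed.

Lemma nim_counts_decr c i : 0 < c i -> nim_counts (decr c i) =
  nim_stats (~~ odd (total c)) (largest (decr c i)) (excess c - (1 < c i)).
Proof.
by move=> ci; rewrite (total_decr ci) (excess_decr ci) oddS negbK addnK.
Qed.

Ltac stats := rewrite /nim_stats; repeat case: ifP; lia.

(** The two halves of the mex characterisation at a non-terminal position: no option has the same
    value, and every smaller value is attained. Since [total] changes parity with each move, only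
    the change of d has to be followed. *)
Lemma nim_counts_large c i : 1 < c i ->
  (forall j, 0 < c j -> nim_counts (decr c j) != nim_counts c) /\
  (forall n, n < nim_counts c ->
     exists2 j, 0 < c j & nim_counts (decr c j) = n).
Proof.
move=> ci1; have M2 : 1 < largest c by apply: leq_trans (leq_largest c i).
(* From here on [i] is a largest part. *)
have [{ci1}i ciM] : exists i, c i = largest c.
  by exists [arg max_(j > i) c j]; rewrite /largest (bigop.bigmax_eq_arg i).
have ci0 : 0 < c i by lia.
have EgeM : (c i).-1 <= excess c by rewrite /excess (bigD1 i) //= leq_addr.
have EltN := excess_lt_total ci0.
have [[j ji cjM]|noj] := pselect (exists2 j, j != i & c j = largest c).
  (* Two largest parts give E >= 2M - 2, so d <= 1, and no single move lowers M. *)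
  have E2 := @excess_two c _ _ ji.
  have lrg l : largest (decr c l) = largest c.
    have [->|li] := eqVneq l i; first exact: largest_decr cjM.
    by apply: largest_decr ciM; rewrite eq_sym.
  split=> [l cl|n].
    rewrite nim_counts_decr // lrg /nim_counts; have := excess_decr cl.
    by stats.
  have [E2lt|E2ge] := ltnP (2 * largest c - 2) (excess c).
    move=> nlt; exists i => //; move: nlt.
    by rewrite nim_counts_decr // lrg /nim_counts; stats.
  case: n => [|n] nlt; last first.
    exists i => //; move: nlt.
    by rewrite nim_counts_decr // lrg /nim_counts; stats.
  (* Here d = 1 and the total is odd. Value 0 needs a move that keeps d, and the odd total differs
     from 2M, so a part of size 1 exists. *)
  have [||l _ cl] := @exists_third c j i ji; first by lia.
    by move: nlt; rewrite /nim_counts; stats.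
  exists l; first by rewrite cl.
  by move: nlt; rewrite nim_counts_decr ?cl // lrg /nim_counts; stats.
(* Now [i] is the only largest part. *)
have uni j : j != i -> c j < largest c.
  move=> ji; rewrite ltn_neqAle leq_largest andbT; apply/eqP => cj.
  by apply: noj; exists j.
have lrgi := largest_decr_uniq ciM uni.
have lrg j : j != i -> largest (decr c j) = largest c.
  by rewrite eq_sym => ji; apply: largest_decr ciM.
(* Needed when taking from [i] lowers M to 1, where [nim_stats] switches to its terminal value 0. *)
have E1 : largest c <= 2 -> excess c <= 1.
  move=> M2'; rewrite leqNgt; apply/negP => Egt1.
  have [|j /uni] := @exists_excess c i; lia.
split=> [l cl|n nlt].
  have := excess_decr cl; rewrite nim_counts_decr // /nim_counts.
  have [->|li] := eqVneq l i; first by rewrite lrgi; stats.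
  rewrite lrg //; case: (ltnP 1 (c l)) => cl1.
    by have := @excess_two c _ _ li; stats.
  by stats.
have takei : nim_stats (~~ odd (total c)) (largest c).-1 (excess c).-1 = n ->
    exists2 j, 0 < c j & nim_counts (decr c j) = n.
  move=> <-; exists i => //; rewrite nim_counts_decr // lrgi ciM M2.
  by rewrite subn1.
have take2 : (c i).-1 < excess c ->
    nim_stats (~~ odd (total c)) (largest c) (excess c).-1 = n ->
    exists2 j, 0 < c j & nim_counts (decr c j) = n.
  move=> /exists_excess[j ji cj] <-; exists j; first by lia.
  by rewrite nim_counts_decr ?lrg ?cj ?subn1 //; lia.
(* The chosen part may or may not have size at least 2; [b] covers both possibilities. *)
have take1 : c i < total c ->
    (forall b : bool, nim_stats (~~ odd (total c)) (largest c) (excess c - b) = n) ->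
    exists2 j, 0 < c j & nim_counts (decr c j) = n.
  move=> /exists_total[j ji cj] nE; exists j => //.
  by rewrite nim_counts_decr // lrg.
move: nlt; rewrite /nim_counts.
case oddN: (odd (total c)) in takei take1 take2 *; last first.
  move=> nlt; have {nlt} [n0 dge2] : n = 0 /\ excess c + 2 < 2 * largest c.
    by move: nlt; stats.
  (* For d >= 4, taking from [i] leaves d >= 3 with an odd total. *)
  have [d4|d4] := leqP (excess c + 5) (2 * largest c).
    by apply: takei; stats.
  (* For d = 3, the even total forces another nonempty part; taking from it leaves d at 3 or 4. *)
  have [d3|d3] := eqVneq (2 * largest c) (excess c + 4).
    by apply: take1 => [|[]]; [lia|stats|stats].
  (* For d = 2, shrinking another part of size at least 2 gives d = 3. If there is none, E = M - 1
     forces M = 2, and taking from [i] ends the game. *)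
  have [E0|E0] := ltnP (c i).-1 (excess c); first by apply: take2 => //; stats.
  by apply: takei; stats.
case: n => [|n] in takei take1 take2 * => nlt.
  by apply: takei; move: nlt; stats.
(* Value 1 must be reached from d = 1 or d = 2. In the first case E > M - 1 supplies another part of
   size at least 2; in the second any move outside [i] leaves d at 2 or 3. *)
have [d1|d1] := eqVneq (2 * largest c) (excess c + 2).
  by apply: take2; [lia|move: nlt; stats].
by apply: take1 => [|[]]; move: nlt; stats.
Qed.

End PartCounts.

(** * Hulls in complete multipartite graphs *)

Section Hull.
Variables (k : nat) (m : 'I_k -> nat).
Let G := complete_multipartite m.
Implicit Types (x y : G) (S P : {set G}).

(** Distinct vertices of [S] lie in different parts, so the only shortest path between them is an
    edge. *)
Lemma clique_convex S :
  {in S &, forall x y, tag x = tag y -> x = y} -> convex S.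
Proof.
move=> clq x y p xS yS [[xp yE] minp] v.
have [xy|xy] := eqVneq x y.
  have := minp [::] (conj isT xy); rewrite leqn0 size_eq0 => /eqP->.
  by rewrite mem_seq1 => /eqP->.
have nadj : tag x != tag y by apply: contra_neq xy; apply: clq.
have := minp [:: y]; rewrite /walk /= /cmp_adj nadj => /(_ (conj isT erefl)).
case: p xp yE {minp} => [_ /= xy0|z [|//] _ /= -> _]; first by rewrite xy0 eqxx in xy.
by rewrite !inE => /orP[]/eqP->.
Qed.

(** Vertices of one part are at distance 2, so the path through [v] is a shortest one. *)
Lemma convex_other_part S x y v : convex S -> x \in S -> y \in S -> x != y ->
  tag x = tag y -> tag v != tag x -> v \in S.
Proof.
move=> cS xS yS xy txy tvx; apply: (cS x y [:: v; y] xS yS); last by rewrite !inE eqxx orbT.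
split=> [|[|z [|//]]].
- by rewrite /walk /= /cmp_adj -txy tvx eq_sym tvx.
- by case=> _ /= xyE; rewrite xyE eqxx in xy.
- by case=> /= /andP[xz _] zy; rewrite zy /cmp_adj txy eqxx in xz.
Qed.

(** Without such a pair, [S] is a clique, hence its own hull and not everything. With one, the hull
    contains all other parts; one of these has two vertices, which in turn bring in the part of the
    pair. *)
Lemma hull_full S (i j : 'I_k) : i != j -> 1 < m i -> 1 < m j ->
  (hull S == [set: G]) =
  [exists x in S, exists y in S, (x != y) && (tag x == tag y)].
Proof.
move=> ij mi mj.
have two l : 1 < m l -> exists x y : G, [/\ x != y, tag x = l & tag y = l].
  move=> ml; exists (Tagged (fun i => 'I_(m i)) (Ordinal (ltnW ml))).
  exists (Tagged (fun i => 'I_(m i)) (Ordinal ml)); split=> //.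
  by rewrite eq_Tagged.
apply/eqP/exists_inP => [hT|[x xS /exists_inP[y yS /andP[xy /eqP txy]]]].
  apply: contrapT => no.
  have clq : {in S &, forall x y, tag x = tag y -> x = y}.
    move=> x y xS yS txy; apply: contrapT => /eqP xy; apply: no.
    by exists x => //; apply/exists_inP; exists y; rewrite ?xy ?txy ?eqxx.
  have sub := hull_min (clique_convex clq) (subxx S).
  have [x [y [xy tx ty]]] := two i mi.
  have inS z : z \in S by apply: (subsetP sub); rewrite hT inE.
  by move/eqP: xy; apply; apply: clq => //; rewrite tx.
have cH := @convex_hull G S; have sH := subsetP (sub_hull S).
have other v : tag v != tag x -> v \in hull S.
  by apply: (convex_other_part cH (sH x xS) (sH y yS) xy txy).
have [l lx ml] : exists2 l, l != tag x & 1 < m l.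
  have [ix|ix] := eqVneq i (tag x); last by exists i.
  by exists j => //; rewrite -ix eq_sym.
have [z [w [zw tz tw]]] := two l ml.
apply/setP => v; rewrite inE; have [vx|vx] := eqVneq (tag v) (tag x); last exact: other.
apply: (convex_other_part cH (other z _) (other w _) zw); rewrite ?tz ?tw //.
by rewrite vx eq_sym.
Qed.

(** * Positions as tuples of remaining part sizes *)

Definition part_count S (i : 'I_k) := #|[set x in S | tag x == i]|.

Lemma part_count_remove P v : v \notin P ->
  part_count (~: (v |: P)) =1 decr (part_count (~: P)) (tag v).
Proof.
move=> vP i; rewrite /part_count /decr.
rewrite (cardsD1 v [set x in ~: P | tag x == i]) !inE vP /= eq_sym addnC addnK.
by congr #|pred_of_set _|; apply/setP => x; rewrite !inE negb_or andbA.
Qed.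

Lemma eq_nim_counts (I : finType) (c c' : I -> nat) :
  c =1 c' -> nim_counts c = nim_counts c'.
Proof. by move=> /funext->. Qed.

Lemma part_count_gt0 S i : 0 < part_count S i -> exists2 x, x \in S & tag x = i.
Proof.
by case/card_gt0P => x; rewrite inE => /andP[xS /eqP]; exists x.
Qed.

Lemma part_count_gt1 S i : 1 < part_count S i ->
  [exists x in S, exists y in S, (x != y) && (tag x == tag y)].
Proof.
case/card_gt1P => x [y []]; rewrite !inE => /andP[xS /eqP tx] /andP[yS /eqP ty] xy.
by apply/exists_inP; exists x => //; apply/exists_inP; exists y; rewrite ?xy ?tx ?ty /=.
Qed.

(** Induction on the number of remaining vertices: a move decrements one count, so the mex recursion
    of the game becomes the one on counts. *)
Lemma ter_nim_counts (i j : 'I_k) P : i != j -> 1 < m i -> 1 < m j ->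
  @ter_nim G P = nim_counts (part_count (~: P)).
Proof.
move=> ij mi mj; have [n] := ubnP #|~: P|; elim: n P => // n IHn P ltPn.
have optE v : v \notin P ->
    @ter_nim G (v |: P) = nim_counts (decr (part_count (~: P)) (tag v)).
  move=> vP; rewrite -(eq_nim_counts (part_count_remove vP)); apply: IHn.
  rewrite ltnS in ltPn; apply: leq_trans ltPn; apply: proper_card; rewrite properE setCS subsetU1 setCS.
  by apply: contra vP => /subsetP; apply; rewrite setU11.
rewrite ter_nimE /ter_options (hull_full _ ij mi mj).
case: ifP => [/exists_inP[x xP /exists_inP[y yP /andP[xy /eqP txy]]]|/negbT no].
  have [|ne lt] := @nim_counts_large _ (part_count (~: P)) (tag x).
    by apply/card_gt1P; exists x, y; rewrite !inE in xP yP *; rewrite xP yP txy eqxx.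
  apply: mex_eq => [|a /lt[l /part_count_gt0[v vP <-] <-]].
    apply/mapP => -[Q]; rewrite mem_enum => /imsetP[v vP ->].
    rewrite inE in vP; rewrite optE // => /esym/eqP; apply/negP/ne.
    by apply/card_gt0P; exists v; rewrite !inE vP eqxx.
  apply/mapP; exists (v |: P); last by rewrite optE // -in_setC.
  by rewrite mem_enum; apply: (imset_f (fun v => v |: P)).
rewrite nim_counts_small; last first.
  by move=> l; rewrite leqNgt; apply: contra no; apply: part_count_gt1.
by apply: mex_eq => //; apply/mapP => -[Q]; rewrite mem_enum inE.
Qed.

Lemma part_countT i : part_count [set: G] i = m i.
Proof.
have inj : injective (fun x : 'I_(m i) => Tagged (fun i => 'I_(m i)) x : G).
  by move=> x y /eqP; rewrite eq_Tagged => /eqP.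
rewrite /part_count -[RHS]card_ord -(card_imset predT inj).
apply: eq_card => -[j x]; rewrite !inE /=.
apply/eqP/imsetP => [ji|[y _ /(congr1 tag)] //].
by case: _ / ji x => x; exists x.
Qed.

Lemma card_complete_multipartite : #|G| = \sum_i m i.
Proof.
by rewrite card_tagged sumnE big_map -big_enum /=; apply: eq_bigr => i _; rewrite card_ord.
Qed.

End Hull.

(* The parts have sizes m 1, ..., m k; other values of m are irrelevant. *)
Theorem proposition5p15 (k : nat) (m : nat -> nat)
    (hk : 2 <= k)
    (hm1 : 1 <= m 1)
    (hmono : forall i, 1 <= i < k -> m i <= m i.+1)
    (hmk : 2 <= m k)
    (hlambda : 2 <= #|[set i : 'I_k | 2 <= m i.+1]|) :
  let G := complete_multipartite (fun i : 'I_k => m i.+1) in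
  let d : int := ((m k)%:Z - \sum_(1 <= i < k) ((m i)%:Z - 1))%R in
  [/\ ~~ odd #|G| -> (d <= 1)%R -> nim_TER G = 0,
      ~~ odd #|G| -> (2 <= d)%R -> nim_TER G = 1,
      odd #|G| -> (d <= 0)%R -> nim_TER G = 1,
      odd #|G| -> d = 1%R \/ d = 2%R -> nim_TER G = 2
    & odd #|G| -> (3 <= d)%R -> nim_TER G = 0].
Proof.
move=> G d.
have [i [j [i2 j2 ij]]] := card_gt1P hlambda; rewrite !inE in i2 j2.
have nimE : nim_TER G = nim_counts (fun i : 'I_k => m i.+1).
  rewrite /nim_TER (ter_nim_counts set0 ij i2 j2) setC0.
  exact: eq_nim_counts (@part_countT _ _).
have mono a b : 1 <= a -> a <= b <= k -> m a <= m b.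
  move=> a1; elim: b => [|b IHb]; first by lia.
  rewrite leq_eqVlt ltnS => /andP[/orP[/eqP->//|ab] bk].
  by apply: leq_trans (hmono b _); [apply: IHb|]; lia.
have pos a : 1 <= a <= k -> 1 <= m a.
  by move=> ak; apply: leq_trans hm1 (mono _ _ _ _).
have lrg : largest (fun i : 'I_k => m i.+1) = m k.
  apply/eqP; rewrite eqn_leq; apply/andP; split.
    by apply/bigmax_leqP => l _; apply: mono; rewrite // ltn_ord leqnn.
  case: k hk {G d hlambda i j ij i2 j2 nimE hmono hmk mono pos} => // k' _.
  exact: (leq_largest (fun i : 'I_k'.+1 => m i.+1) ord_max).
have exc : excess (fun i : 'I_k => m i.+1) = \sum_(1 <= a < k) (m a).-1 + (m k).-1.
  rewrite /excess -(big_mkord xpredT (fun a => (m a.+1).-1)).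
  by rewrite -big_nat_recr ?big_add1 //; lia.
(* All parts are nonempty, so the truncated predecessor agrees with integer subtraction. *)
have dE : d = ((m k)%:Z - (\sum_(1 <= a < k) (m a).-1)%:Z)%R.
  rewrite /d; congr (_ - _)%R; rewrite -natz natr_sum; apply: eq_big_nat => a ak.
  by have := pos a; lia.
rewrite nimE /nim_counts /total -card_complete_multipartite -/G lrg exc dE.
by split; rewrite /nim_stats; repeat case: ifP; lia.
Qed.
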